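(* Let $G$ be a (non-free) Artin group of almost large type with standard generating set $\{a_1,\dots,a_n\}$ and Coxeter matrix $(m_{ij})$, and let $\mathcal X$ be the Huang–Osajda systolic complex for $G$, with $v_0$ the vertex of $\mathcal X$ corresponding to the identity element of $G$. Suppose that, for each $i,j$, $\Pi_0^{ij}$ is a precell within $\mathcal X_{ij}$ with initial vertex $v_0$. Suppose that the set $V_0$ of representatives of the $G$-orbits of simplices of $\mathcal X$ is chosen such that, for each parabolic subgroup $G_{ij}=\langle a_i,a_j\rangle$ of $G$, the orbit representatives for $G_{ij}$ (the members of $V_0$ that are simplices of $\mathcal X_{ij}$, which represent the $G_{ij}$-orbits of simplices of $\mathcal X_{ij}$) are based on $\Pi_0^{ij}$. Then each of the sets $\mathcal A$ and $\mathcal B$ consists of (a set representing) the union of complete sets of Garside generators for the subgroups $G_{ij}$, together with their inverses and the identity element. (Here $i,j$ range over the pairs $i\ne j$ with $m_{ij}<\infty$, for which $\mathcal X_{ij}$, precells and Garside generators are defined.)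
   Context: **Artin groups.** Let $(m_{ij})$ be a Coxeter matrix: a symmetric $n\times n$ matrix with $m_{ii}=1$ and $m_{ij}\in\{2,3,\dots\}\cup\{\infty\}$ for $i\ne j$. For $m\in\mathbb N$ let ${}_m(a,a')$ be the alternating word of length $m$ in $a,a'$ starting with $a$. The Artin group is $G=\langle a_1,\dots,a_n\mid {}_{m_{ij}}(a_i,a_j)={}_{m_{ij}}(a_j,a_i)\ (i\ne j,\ m_{ij}<\infty)\rangle$. Its Coxeter diagram has nodes $1,\dots,n$ and an edge labelled $m_{ij}$ joining each pair $i\ne j$. $G$ has almost large type if (1) in any triangle of edges of the diagram either at least one edge is labelled $\infty$ or no edge has label 2, and (2) in any square (4-cycle) of edges either at least one edge is labelled $\infty$ or at most one edge has label 2. For $m_{ij}<\infty$, $\Delta_{ij}$ is the element of $G_{ij}$ represented by ${}_{m_{ij}}(a_i,a_j)$; the Garside generators of $G_{ij}$ are the elements represented by the words ${}_k(a_i,a_j)$ and ${}_k(a_j,a_i)$ with $1\le k\le m_{ij}$. **The complex $\mathcal X$.** Let $\mathcal G$ be the (undirected) Cayley graph of $G$ over $\{a_1,\dots,a_n\}$: vertex set $G$, edges $\{g,ga_i\}$; $G$ acts by left multiplication. For each pair $i\neq j$ with $m=m_{ij}<\infty$ and each $g\in G$ there is a precell: the $2m$-cycle in $\mathcal G$ formed by its two half boundaries, the paths $p_0=g,p_1,\dots,p_m=g\Delta_{ij}$ labelled ${}_m(a_i,a_j)$ and $q_0=g,q_1,\dots,q_m=g\Delta_{ij}$ labelled ${}_m(a_j,a_i)$;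 $g$ is its initial vertex and $g\Delta_{ij}$ its terminal vertex. Each precell is triangulated: if $m=2$, by adding the edge $\{p_0,p_2\}$; if $m\ge3$, by adding $m-2$ new vertices $o_1,\dots,o_{m-2}$ and the edges $\{p_0,o_1\}$, $\{o_{m-2},p_m\}$, $\{o_s,o_{s+1}\}$ $(1\le s\le m-3)$, and $\{o_s,p_s\},\{o_s,p_{s+1}\},\{o_s,q_s\},\{o_s,q_{s+1}\}$ $(1\le s\le m-2)$. The added vertices and edges are the interior vertices and interior edges of the precell; elements of $G$ are called real vertices and edges of $\mathcal G$ real edges. Next, whenever two distinct precells $\Pi,\Pi'$ for the same pair $\{i,j\}$ have boundaries meeting in a path with $l\ge2$ edges (this path is then a proper suffix of a half boundary of one, say $\Pi$, and a proper prefix of a half boundary of the other, $\Pi'$), then, writing $o_1,\dots,o_{m-2}$ and $o'_1,\dots,o'_{m-2}$ for the interior vertices of $\Pi$ and $\Pi'$ respectively, each list numbered in order from the initial vertex to the terminal vertex of its precell, and $d_s=o_{m-1-l+s}$, $d'_s=o'_s$ for $1\le s\le l-1$, one adds the edges $\{d_s,d'_s\}$ $(1\le s\le l-1)$ and $\{d'_s,d_{s+1}\}$ $(1\le s\le l-2)$. The complex $\mathcal X_{ij}$ is the flag simplicial complex whose 1-skeleton is the graph obtained in this way from the Cayley graph of $G_{ij}$ (that is, using the precells with $g\in G_{ij}$). The complex $\mathcal X$ is the union of $\mathcal G$ and all translates $h\mathcal X_{ij}$ ($h\in G$, $m_{ij}<\infty$), one for each coset $hG_{ij}$, distinct translates being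 glued only along their common part in $\mathcal G$. $G$ acts on $\mathcal X$, extending its action on $\mathcal G$, with trivial simplex stabilisers, and $\mathcal X$ is systolic. **Labels and the sets $\mathcal A,\mathcal B$.** Let $V_0\ni v_0$ be a set of representatives of the orbits of $G$ on the set of (non-empty) simplices of $\mathcal X$. For a simplex $\sigma$, let $\bar\sigma\in V_0$ be its orbit representative, and let $\lambda_\sigma$ be the unique element of $G$ with $\sigma=\lambda_\sigma\bar\sigma$. Then $\mathcal B$ consists of symbols representing the identity and all elements $\lambda_\sigma^{-1}\lambda_\tau$ where $\sigma,\tau$ are simplices with $\sigma\subset\tau$ or $\tau\subset\sigma$; and $\mathcal A$ consists of symbols representing the identity and all elements $\lambda_\rho^{-1}\lambda_\tau$ where $\rho,\tau$ are disjoint simplices that together span a simplex of $\mathcal X$. **''Based on''.** A set $V$ of orbit representatives for the action of a 2-generator Artin group $G_{ij}$ on the simplices of $\mathcal X_{ij}$ is based on the precell $\Pi_0$ with initial vertex $v_0$ if: (1) $V$ contains $v_0$ and the two real edges through $v_0$ on the boundary of $\Pi_0$; (2) $V$ contains all the interior vertices and edges of $\Pi_0$; (3) any simplex in $V$ contains at least one vertex within $\Pi_0$.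
   Formalization: ''Non-free'' is strengthened: every generator a_i must have some j ≠ i with m_ij finite. In clause (3) of ''based on'', a vertex ''within'' the precell means v_0 or an interior vertex; other boundary vertices do not count. Without these the claim fails. *)

(* Defs.v *)
From mathcomp Require Export all_boot all_algebra.
From mathcomp Require Export mathcomp_extra boolp classical_sets cardinality.

Set Implicit Arguments.
Unset Strict Implicit.
Unset Printing Implicit Defensive.

Local Open Scope classical_set_scope.
Local Open Scope group_scope.

(* [alt k x y] is the product x * y * x * ... of k alternating factors. *)
Fixpoint alt (G : groupType) (k : nat) (x y : G) : G :=
  if k is k'.+1 then x * alt k' y x else 1.

(* [None] stands for the label infinity. *)
Definition coxeter_matrix n (m : 'M[option nat]_n) : Prop :=
  [/\ forall i j, m i j = m j i,
      forall i, m i i = Some 1%N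
    & forall i j k, i != j -> m i j = Some k -> (2 <= k)%N].

Definition almost_large_type n (m : 'M[option nat]_n) : Prop :=
  (forall i j k : 'I_n, uniq [:: i; j; k] ->
     let labels := [:: m i j; m j k; m k i] in
     None \in labels \/ Some 2 \notin labels) /\
  (forall i j k l : 'I_n, uniq [:: i; j; k; l] ->
     let labels := [:: m i j; m j k; m k l; m l i] in
     None \in labels \/ (count_mem (Some 2) labels <= 1)%N).

Definition artin_relations n (m : 'M[option nat]_n) (G : groupType)
    (a : 'I_n -> G) : Prop :=
  forall i j k, i != j -> m i j = Some k -> alt k (a i) (a j) = alt k (a j) (a i).

(* G is presented by the generators [a i] and the Artin relations, expressed by
   the universal property of a presentation. *)
Definition artin_group n (m : 'M[option nat]_n) (G : groupType)
    (a : 'I_n -> G) : Prop :=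
  artin_relations m a /\
  forall (H : groupType) (b : 'I_n -> H), artin_relations m b ->
  exists f : {multiplicative G -> H},
    (forall i, f (a i) = b i) /\
    forall f' : {multiplicative G -> H}, (forall i, f' (a i) = b i) -> f' =1 f.

Definition free_basis (G : groupType) (S : set G) : Prop :=
  forall (H : groupType) (b : G -> H),
  exists f : {multiplicative G -> H},
    (forall x, S x -> f x = b x) /\
    forall f' : {multiplicative G -> H}, (forall x, S x -> f' x = b x) -> f' =1 f.

Definition free_group (G : groupType) : Prop :=
  exists S : set G, free_basis S.

(* No generator has only infinite labels, so that every edge of the Cayley graph
   lies in a translate of some X_ij.  Otherwise {1, a_i} with a_i isolated puts
   a_i in [setA], although a_i is in no G_jk with m_jk finite. *)
Definition no_isolated_generator n (m : 'M[option nat]_n) : Prop :=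
  forall i, exists2 j, i != j & m i j <> None.

Definition is_subgroup (G : groupType) (H : set G) : Prop :=
  H 1 /\ forall x y, H x -> H y -> H (x / y).

(* [Real g] is a vertex of the Cayley graph; [Inner g [set i; j] s] is the
   vertex o_s of the precell for {i, j} with initial vertex g.  Only the values
   1 <= s <= m_ij - 2 occur in the complex. *)
Inductive vertex (G : groupType) (n : nat) : Type :=
  | Real of G
  | Inner of G & {set 'I_n} & nat.

Arguments Real {G n} g : rename.
Arguments Inner {G n} g e s : rename.

Definition act (G : groupType) n (h : G) (v : vertex G n) : vertex G n :=
  match v with
  | Real g => Real (h * g)
  | Inner g e s => Inner (h * g) e s
  end.

Definition translate (G : groupType) n (h : G) (sigma : set (vertex G n)) :
  set (vertex G n) := act h @` sigma.

(* V contains exactly one element of each H-orbit on S. *)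
Definition orbit_representatives (G : groupType) n (H : set G)
    (S V : set (set (vertex G n))) : Prop :=
  V `<=` S /\
  forall sigma, S sigma ->
  exists! tau, V tau /\ exists2 h, H h & sigma = translate h tau.

Section Complex.
Context (G : groupType) (n : nat) (m : 'M[option nat]_n) (a : 'I_n -> G).
Implicit Types (g h : G) (i j : 'I_n) (p : 'I_n * 'I_n) (V : set (set (vertex G n))).

Definition orders i j : set ('I_n * 'I_n) := [set (i, j); (j, i)].

(* The t-th vertex of the half boundary, with labels alternating from [a p.1]
   to [a p.2], of the precell with initial vertex g. *)
Definition half g p (t : nat) : G := g * alt t (a p.1) (a p.2).

Definition boundary_vertices i j (M : nat) g : set G :=
  [set half g p t | p in orders i j & t in `I_M.+1].

Definition boundary_edges i j (M : nat) g : set (set G) :=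
  [set [set half g p t; half g p t.+1] | p in orders i j & t in `I_M].

(* The boundaries of the precells at g and g' meet in a path with l >= 2 edges,
   a proper suffix of a half boundary at g and a proper prefix of one at g'. *)
Definition overlap i j (M : nat) g g' (l : nat) : Prop :=
  [/\ g <> g', (2 <= l < M)%N &
   exists p p' : 'I_n * 'I_n,
   [/\ orders i j p /\ orders i j p',
       forall t, (t <= l)%N -> half g p (M - l + t) = half g' p' t,
       boundary_vertices i j M g `&` boundary_vertices i j M g' =
         [set half g' p' t | t in `I_l.+1]
     & boundary_edges i j M g `&` boundary_edges i j M g' =
         [set [set half g' p' t; half g' p' t.+1] | t in `I_l]]].

Definition inner i j g (s : nat) : vertex G n := Inner g [set i; j]%SET s.

Definition cell_interior_vertices i j (M : nat) g : set (vertex G n) :=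
  [set inner i j g s | s in [set s | (1 <= s <= M - 2)%N]].

Inductive cell_interior_edge i j (M : nat) g : vertex G n -> vertex G n -> Prop :=
  | Diagonal_edge : M = 2 ->
      cell_interior_edge i j M g (Real g) (Real (half g (i, j) M))
  | First_edge : (3 <= M)%N ->
      cell_interior_edge i j M g (Real g) (inner i j g 1)
  | Last_edge : (3 <= M)%N ->
      cell_interior_edge i j M g (inner i j g (M - 2)) (Real (half g (i, j) M))
  | Spine_edge s : (1 <= s <= M - 3)%N ->
      cell_interior_edge i j M g (inner i j g s) (inner i j g s.+1)
  | Spoke_edge s p t : (1 <= s <= M - 2)%N -> orders i j p -> t = s \/ t = s.+1 ->
      cell_interior_edge i j M g (inner i j g s) (Real (half g p t)).

Inductive link_edge i j (M : nat) g g' : vertex G n -> vertex G n -> Prop :=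
  | Link_same l s : overlap i j M g g' l -> (1 <= s <= l - 1)%N ->
      link_edge i j M g g' (inner i j g (M - 1 - l + s)) (inner i j g' s)
  | Link_next l s : overlap i j M g g' l -> (1 <= s <= l - 2)%N ->
      link_edge i j M g g' (inner i j g' s) (inner i j g (M - 1 - l + s.+1)).

Definition parabolic i j : set G :=
  smallest (@is_subgroup G) [set a i; a j].

Definition Xij_vertices i j (M : nat) : set (vertex G n) :=
  [set v | exists2 g, parabolic i j g &
           v = Real g \/ cell_interior_vertices i j M g v].

Definition Xij_edge i j (M : nat) (u v : vertex G n) : Prop :=
  (exists2 g, parabolic i j g &
     [/\ u = Real g & v = Real (g * a i) \/ v = Real (g * a j)] \/
     cell_interior_edge i j M g u v) \/
  (exists g g', [/\ parabolic i j g, parabolic i j g' & link_edge i j M g g' u v]).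

(* A simplex is encoded by its set of vertices; X_ij is a flag complex. *)
Definition Xij_simplices i j (M : nat) : set (set (vertex G n)) :=
  [set sigma | [/\ finite_set sigma, sigma !=set0,
     sigma `<=` Xij_vertices i j M
   & forall u v, sigma u -> sigma v -> u <> v ->
       Xij_edge i j M u v \/ Xij_edge i j M v u]].

(* Interior vertices determine their precell, so the translates of the X_ij
   share no vertex outside the Cayley graph. *)
Definition X_simplices : set (set (vertex G n)) :=
  [set sigma |
    [\/ exists g, sigma = [set Real g],
        exists g i, sigma = [set Real g; Real (g * a i)]
      | exists i j M h tau,
        [/\ i != j, m i j = Some M, Xij_simplices i j M tau
          & sigma = translate h tau]]].

(* The element lambda with sigma = lambda tau for some tau in V0.  It is unique
   since simplex stabilisers are trivial, so the choice made by [xget] is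
   immaterial. *)
Definition label V0 (sigma : set (vertex G n)) : G :=
  xget 1 [set g | exists2 tau, V0 tau & sigma = translate g tau].

Definition setA V0 : set G :=
  [set 1] `|`
  [set x | exists rho tau,
     [/\ X_simplices rho /\ X_simplices tau, rho `&` tau = set0,
         X_simplices (rho `|` tau)
       & x = (label V0 rho)^-1 * label V0 tau]].

Definition setB V0 : set G :=
  [set 1] `|`
  [set x | exists sigma tau,
     [/\ X_simplices sigma, X_simplices tau, sigma `<=` tau \/ tau `<=` sigma
       & x = (label V0 sigma)^-1 * label V0 tau]].

(* V is based on the precell with initial vertex 1.  In the last clause a
   vertex "within" the precell is an interior vertex or the initial vertex: the
   other boundary vertices have to be excluded.  For instance, for M = 2 the
   triangle {1, a_i, a_i a_j} could otherwise be represented by its translate by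
   a_j^-1, which contains a_i, and a_i^-1 a_j would be an element of [setB]. *)
Definition based_on i j (M : nat) V : Prop :=
  [/\ [/\ V [set Real 1], V [set Real 1; Real (a i)] & V [set Real 1; Real (a j)]],
      (forall v, cell_interior_vertices i j M 1 v -> V [set v]) /\
      (forall u v, cell_interior_edge i j M 1 u v -> V [set u; v])
    & forall sigma, V sigma ->
      exists2 v, sigma v & v = Real 1 \/ cell_interior_vertices i j M 1 v].

Definition garside_generators i j (M : nat) : set G :=
  [set alt k (a p.1) (a p.2) | p in orders i j & k in [set k | (1 <= k <= M)%N]].

(* The Garside generators of all G_ij with m_ij finite, their inverses and 1. *)
Definition garside_set : set G :=
  [set 1] `|`
  [set x | exists i j M,
     [/\ i != j, m i j = Some M
       & garside_generators i j M x \/ garside_generators i j M x^-1]].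

End Complex.

(* Main.v *)
(* Write the origin of a vertex for itself if it is real, and for the initial
   vertex of its precell if it is interior.  Since V0 is based on the precells
   with initial vertex 1, the label of a simplex is the origin of one of its
   vertices.  Running through the edges of X_ij, the origins of two vertices of a
   common simplex differ by 1, a Garside generator or the inverse of one, so
   both sets are contained in the Garside set.  Conversely, the edges {1, a_i},
   {1, a_i a_j} (for m_ij = 2), {o_s, p_t} and {o_(m-2), p_m} of the precell at 1
   belong to V0; they and their endpoints realise every Garside generator.  That
   the first two are not inverted by G follows from the homomorphism to Z/3
   sending every a_i to 1. *)

Require Import Defs.
From mathcomp Require Import zify.

Set Implicit Arguments.
Unset Strict Implicit.
Unset Printing Implicit Defensive.

Local Open Scope classical_set_scope.
Local Open Scope group_scope.

(** * Origins and the translation action *)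

Definition origin (G : groupType) n (v : vertex G n) : G :=
  match v with Real g => g | Inner g _ _ => g end.

Lemma origin_act (G : groupType) n h (v : vertex G n) :
  origin (act h v) = h * origin v.
Proof. by case: v. Qed.

Lemma translateM (G : groupType) n g h (sigma : set (vertex G n)) :
  translate g (translate h sigma) = translate (g * h) sigma.
Proof.
by rewrite /translate image_comp; apply: eq_imagel => -[x|x e s] _ /=;
  rewrite mulgA.
Qed.

Lemma translate1 (G : groupType) n (sigma : set (vertex G n)) :
  translate 1 sigma = sigma.
Proof.
rewrite /translate -[RHS]image_id; apply: eq_imagel => -[x|x e s] _ /=;
  by rewrite mul1g.
Qed.

Lemma translate_set1 (G : groupType) n g (v : vertex G n) :
  translate g [set v] = [set act g v].
Proof. exact: image_set1. Qed.

(** * Quotients of origins within a simplex *)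

Section Garside.
Context (G : groupType) (n : nat) (m : 'M[option nat]_n) (a : 'I_n -> G).

Lemma garside_set1 : garside_set m a 1.
Proof. by left. Qed.

Lemma garside_setV x : garside_set m a x -> garside_set m a x^-1.
Proof.
case=> [->|[i [j [M [ij mij gx]]]]]; first by rewrite invg1; left.
by right; exists i, j, M; split=> //; rewrite invgK; case: gx; [right|left].
Qed.

Lemma garside_set_alt i j M p k : i != j -> m i j = Some M ->
  orders i j p -> (1 <= k <= M)%N -> garside_set m a (alt k (a p.1) (a p.2)).
Proof.
by move=> ij mij op km; right; exists i, j, M; split=> //; left; exists p => //;
  exists k.
Qed.

Lemma Xij_edge_garside i j M u v : i != j -> m i j = Some M -> (2 <= M)%N ->
  Xij_edge a i j M u v -> garside_set m a ((origin u)^-1 * origin v).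
Proof.
move=> ij mij M2; case=> [[g _ []]|[g [g' [_ _]]]].
- have M1 : (1 <= 1 <= M)%N by exact: ltnW.
  case=> -> [] -> /=; rewrite mulKg.
    have := @garside_set_alt i j M (i, j) 1 ij mij (or_introl erefl) M1.
    by rewrite /= mulg1.
  have := @garside_set_alt i j M (j, i) 1 ij mij (or_intror erefl) M1.
  by rewrite /= mulg1.
- have MM : (1 <= M <= M)%N by rewrite leqnn ltnW.
  case=> [_|_|_|s _|s p t sM op ts] /=; rewrite /half ?mulVg ?mulKg;
    do ?[exact: garside_set1].
  + exact: garside_set_alt ij mij (or_introl erefl) MM.
  + exact: garside_set_alt ij mij (or_introl erefl) MM.
  + apply: (garside_set_alt ij mij op).
    have /andP[s1 sM2] := sM.
    by case: ts => ->; rewrite ?s1 //=; lia.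
(* At [t = 0] the overlap puts g' at position [M - l] on a half boundary at g, and [2 <= l < M]
   keeps this length between 1 and M. *)
- have link l : overlap a i j M g g' l -> garside_set m a (g^-1 * g').
    case=> _ /andP[l2 lM] [p [p' [[op _] /(_ 0%N isT) eq _ _]]].
    move: eq; rewrite addn0 {2}/half /= mulg1 => <-; rewrite mulKg.
    by apply: (garside_set_alt ij mij op); lia.
  case=> l s /link gl _ //=.
  by move: (garside_setV gl); rewrite invgM invgK.
Qed.

(** Every generator has a finite label with some other one, so each real edge lies in a translate of
    some X_ij. *)
Lemma X_simplex_cases sigma : no_isolated_generator m ->
  X_simplices m a sigma ->
  (exists g, sigma = [set Real g]) \/
  exists i j M h tau, [/\ i != j, m i j = Some M, Xij_simplices a i j M tau
    & sigma = translate h tau].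
Proof.
move=> noniso [|[g [i ->]]|]; [by left| |by right].
have [j ij] := noniso i; case mij: (m i j) => [M|] // _.
right; exists i, j, M, g, [set Real 1; Real (a i)].
split=> //; last by rewrite /translate image_setU !image_set1 /= mulg1.
split; first by rewrite finite_setU; split; exact: finite_set1.
- by exists (Real 1); left.
- move=> v [] ->.
    by exists 1; [move=> H [[H1 _] _]|left].
  by exists (a i); [move=> H [_]; apply; left|left].
- have edge : Xij_edge a i j M (Real 1) (Real (a i)).
    left; exists 1; first by move=> H [[H1 _] _].
    by left; split=> //; left; rewrite mul1g.
  by move=> u v [] -> [] -> // _; [left|right].
Qed.

(** Left translation cancels in the quotient of origins, and distinct vertices of a simplex of X_ij
    are adjacent. *)
Lemma X_simplex_garside sigma u v :
  coxeter_matrix m -> no_isolated_generator m -> X_simplices m a sigma ->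
  sigma u -> sigma v -> garside_set m a ((origin u)^-1 * origin v).
Proof.
case=> _ _ m2 noniso /(X_simplex_cases noniso)[[g ->] -> ->|].
  by rewrite mulVg; left.
move=> [i [j [M [h [tau [ij mij [_ _ _ flag] ->]]]]]] [u' tu <-] [v' tv <-].
rewrite !origin_act invgM -mulgA mulKg.
have [<-|uv] := pselect (u' = v'); first by rewrite mulVg; left.
have M2 := m2 i j M ij mij.
have [|] := flag u' v' tu tv uv.
  exact: Xij_edge_garside.
move=> /(Xij_edge_garside ij mij M2)/garside_setV.
by rewrite invgM invgK.
Qed.

End Garside.

(** * Labels and orbit representatives *)

Section Labels.
Context (G : groupType) (n : nat) (m : 'M[option nat]_n) (a : 'I_n -> G).
Context (V0 : set (set (vertex G n))).
Context (V0_reps : orbit_representatives setT (X_simplices m a) V0).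

Lemma label_rep sigma : X_simplices m a sigma ->
  exists2 tau, V0 tau & sigma = translate (label V0 sigma) tau.
Proof.
move=> Xs; have [tau [[Vt [h _ eq]] _]] := V0_reps.2 _ Xs.
by apply: (@xgetPex _ 1 [set g | exists2 tau, V0 tau & sigma = translate g tau]);
  exists h, tau.
Qed.

(** Elements carrying [tau] to the same simplex differ by an element [g] of its stabiliser. *)
Lemma label_translate h tau : X_simplices m a (translate h tau) -> V0 tau ->
  exists2 g, tau = translate g tau & label V0 (translate h tau) = h * g.
Proof.
move=> Xs Vt; have [tau' Vt' eq] := label_rep Xs.
have [t0 [_ uniq]] := V0_reps.2 _ Xs.
have tt' : tau' = tau.
  rewrite -(uniq tau'); last by split=> //; eexists; [|exact: eq].
  by apply: uniq; split=> //; exists h.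
rewrite {tau' Vt'}tt' in eq.
exists (h^-1 * label V0 (translate h tau)); last by rewrite mulVKg.
by rewrite -translateM -eq translateM mulVg translate1.
Qed.

Context (m_noniso : no_isolated_generator m) (V0_v0 : V0 [set Real 1]).
Context (V0_based : forall (i j : 'I_n) (M : nat), i != j -> m i j = Some M ->
       orbit_representatives (parabolic a i j) (Xij_simplices a i j M)
         (V0 `&` Xij_simplices a i j M) /\
       based_on a i j M (V0 `&` Xij_simplices a i j M)).

Lemma label_set1_real g : label V0 [set Real g] = g.
Proof.
have eq : [set Real g] = translate g [set Real 1] :> set (vertex G n).
  by rewrite translate_set1 /= mulg1.
have Xg : X_simplices m a [set Real g] by constructor 1; exists g.
rewrite eq in Xg *; have [k] := label_translate Xg V0_v0.
rewrite translate_set1 /= mulg1 => /seteqP[/(_ _ erefl)[<-] _ ->].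
by rewrite mulg1.
Qed.

Lemma label_origin sigma : X_simplices m a sigma ->
  exists2 v, sigma v & label V0 sigma = origin v.
Proof.
move=> Xs; have [[g ->]|] := X_simplex_cases m_noniso Xs.
  by exists (Real g) => //; rewrite label_set1_real.
move=> [i [j [M [h [tau' [ij mij Xt eq]]]]]].
have [[_ reps] [_ _ based]] := V0_based ij mij.
have [tau [[VXt [k _ eq']] _]] := reps _ Xt.
have [v tv ov] := based _ VXt.
rewrite eq' translateM in eq; rewrite eq in Xs *.
have [g eqg ->] := label_translate Xs VXt.1.
(* [v] has origin 1. The factor [g] may permute the vertices of [tau], so it is kept in the element
   that moves [v]. *)
exists (act (h * k * g) v).
  by rewrite eqg translateM; exists v.
by rewrite origin_act; case: ov => [->|[s _ <-]] /=; rewrite mulg1.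
Qed.

(** * Simplices with trivial label and the elements they realise *)

Lemma label_stab1 tau : X_simplices m a tau -> V0 tau ->
  (forall g, tau = translate g tau -> g = 1) -> label V0 tau = 1.
Proof.
move=> Xt Vt stab; have := @label_translate 1 tau; rewrite translate1.
by case=> // g eq ->; rewrite (stab g eq) mulg1.
Qed.

Lemma X_simplices_Xij i j M sigma : i != j -> m i j = Some M ->
  Xij_simplices a i j M sigma -> X_simplices m a sigma.
Proof.
by move=> ij mij Xs; constructor 3; exists i, j, M, 1, sigma; rewrite translate1.
Qed.

(* An edge {u, x} such that both {u} and {u, x} are labelled 1 puts x and its
   inverse into both sets. *)
Definition edge_witness (x : G) : Prop :=
  exists u : vertex G n,
    [/\ u <> Real x,
        X_simplices m a [set u] /\ label V0 [set u] = 1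
      & X_simplices m a [set u; Real x] /\ label V0 [set u; Real x] = 1].

Lemma edge_witness_setA x : edge_witness x -> setA m a V0 x /\ setA m a V0 x^-1.
Proof.
move=> [u [ux [Xu lu] [Xux _]]].
have Xx : X_simplices m a [set Real x] by constructor 1; exists x.
split; right.
  exists [set u], [set Real x]; split=> //.
    by apply/seteqP; split=> v // -[-> /ux].
  by rewrite lu label_set1_real invg1 mul1g.
exists [set Real x], [set u]; split=> //.
- by apply/seteqP; split=> v // -[-> /esym/ux].
- by rewrite setUC.
- by rewrite lu label_set1_real mulg1.
Qed.

Lemma edge_witness_setB x : edge_witness x -> setB m a V0 x /\ setB m a V0 x^-1.
Proof.
move=> [u [ux _ [Xux lux]]].
have Xx : X_simplices m a [set Real x] by constructor 1; exists x.
have sub : [set Real x] `<=` [set u; Real x] by exact: subsetUr.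
split; right.
  exists [set u; Real x], [set Real x]; split=> //; first by right.
  by rewrite lux label_set1_real invg1 mul1g.
exists [set Real x], [set u; Real x]; split=> //; first by left.
by rewrite lux label_set1_real mulg1.
Qed.

(** A non-trivial g stabilising {1, x} sends 1 to x, so g = x; then x * x lies in {1, x}, which the
    two conditions on x exclude. *)
Lemma real_edge_witness i j M x : i != j -> m i j = Some M ->
  x <> 1 -> x * x <> 1 ->
  (V0 `&` Xij_simplices a i j M) [set Real 1; Real x] -> edge_witness x.
Proof.
move=> ij mij x1 xx1 [Ve Xe]; have Xe' := X_simplices_Xij ij mij Xe.
exists (Real 1); split; first by case=> /esym.
  by split; [constructor 1; exists 1|exact: label_set1_real].
split=> //; apply: label_stab1 => // g eq.
have: [set Real 1; Real x] (Real (g * 1) : vertex G n).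
  by rewrite eq; exists (Real 1) => //; left.
rewrite mulg1 => -[[//]|[gx]]; rewrite gx in eq *.
have: [set Real 1; Real x] (Real (x * x) : vertex G n).
  by rewrite eq; exists (Real x) => //; right.
by case=> -[] // xx; case: x1; apply: (mulgI x); rewrite mulg1.
Qed.

(** An element stabilising {o_s} or the edge fixes o_s, its only interior vertex, and G acts freely
    on interior vertices. *)
Lemma spoke_witness i j M s x : i != j -> m i j = Some M ->
  cell_interior_vertices i j M 1 (inner i j (1 : G) s) ->
  cell_interior_edge a i j M 1 (inner i j (1 : G) s) (Real x) -> edge_witness x.
Proof.
move=> ij mij cs ce; have [_ [_ [/(_ _ cs)[Vu Xu] /(_ _ _ ce)[Ve Xe]] _]] :=
  V0_based ij mij.
have {}Xu := X_simplices_Xij ij mij Xu; have {}Xe := X_simplices_Xij ij mij Xe.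
have stab (g : G) (t : set (vertex G n)) : t (inner i j (1 : G) s) ->
    t `<=` [set inner i j (1 : G) s; Real x] -> t = translate g t -> g = 1.
  move=> t1 tsub eq; have : t (act g (inner i j (1 : G) s)).
    by rewrite eq; exists (inner i j (1 : G) s).
  by move=> /tsub[[]|//]; rewrite mulg1.
exists (inner i j (1 : G) s); split=> //; split=> //; apply: label_stab1 => // g.
  by apply: stab => // v ->; left.
by apply: stab => //; left.
Qed.

Context (m_coxeter : coxeter_matrix m) (G_artin : artin_group m a).

Lemma alt_edge_witness i j M k : i != j -> m i j = Some M -> (1 <= k <= M)%N ->
  edge_witness (alt k (a i) (a j)).
Proof.
move=> ij mij kM; have M2 : (2 <= M)%N by case: m_coxeter => _ _; apply; eauto.
have [_ [[V1 Vi _] [_ Ve] _]] := V0_based ij mij.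
(* In Z/3 the Artin relations hold with every generator sent to 1. A word of length k maps to k, and
   the lengths 1, 2 and 4 needed when M = 2 are non-zero modulo 3. *)
have [f [fa _]] := G_artin.2 _ (fun=> inZp 1 : 'I_3) (fun i j k _ _ => erefl).
have f1 : f 1 = 1 by apply: (mulgI (f 1)); rewrite -gmulfM !mulg1.
have [M3|M3] := ltnP 2 M; last first.
  (* This precell has no interior vertex: the real edge {1, a_i} serves k = 1 and the diagonal
     serves k = 2. *)
  have eM : M = 2 by lia.
  have [k1|k1] := eqVneq k 1%N.
    rewrite k1 /= mulg1; apply: (real_edge_witness ij mij) => //.
      by move=> /(congr1 f); rewrite fa f1.
    by move=> /(congr1 f); rewrite gmulfM fa f1.
  have -> : k = M by lia.
  apply: (real_edge_witness ij mij).
  - by rewrite eM /= mulg1 => /(congr1 f); rewrite gmulfM !fa f1.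
  - by rewrite eM /= mulg1 => /(congr1 f); rewrite !gmulfM !fa f1.
  - by have := Ve _ _ (Diagonal_edge a i j 1 eM); rewrite /half mul1g.
have inn s : (1 <= s <= M - 2)%N ->
    cell_interior_vertices i j M 1 (inner i j (1 : G) s).
  by move=> sM; exists s.
have [kM'|kM'] := eqVneq k M.
  rewrite kM'; apply: (spoke_witness (s := M - 2) ij mij); first by apply: inn; lia.
  by have := Last_edge a i j 1 M3; rewrite /half mul1g.
(* For 0 < k < M the vertex p_k ends a spoke: from o_1 if k = 1, and from o_(k-1) otherwise, where k
   - 1 is at most M - 2. *)
have [s [sM ks]] : exists s, (1 <= s <= M - 2)%N /\ (k = s \/ k = s.+1).
  by have [->|k1] := eqVneq k 1%N; [exists 1%N|exists k.-1]; lia.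
apply: (spoke_witness ij mij (inn s sM)).
have := Spoke_edge a 1 sM (or_introl erefl : orders i j (i, j)) ks.
by rewrite /half mul1g.
Qed.

Lemma garside_edge_witness x : garside_set m a x ->
  [\/ x = 1, edge_witness x | edge_witness x^-1].
Proof.
case=> [->|[i [j [M [ij mij gx]]]]]; first by constructor 1.
have gen y : garside_generators a i j M y -> edge_witness y.
  move=> [p op [k km <-]].
  case: op => -> /=; first exact: alt_edge_witness ij mij km.
  (* Words starting with a_j are handled by exchanging the indices, as the matrix is symmetric. *)
  rewrite eq_sym in ij; case: m_coxeter => sym _ _; rewrite sym in mij.
  exact: alt_edge_witness ij mij km.
by case: gx => /gen; [constructor 2|constructor 3].
Qed.

(** * Comparison of both sets with the Garside set *)

Lemma setA_garside : setA m a V0 = garside_set m a.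
Proof.
apply/seteqP; split=> x.
  case=> [->|[rho [tau [[Xr Xt] _ Xrt ->]]]]; first by left.
  have [u ru ->] := label_origin Xr; have [v tv ->] := label_origin Xt.
  (* Both labels are origins of vertices of the simplex spanned by [rho] and [tau]. *)
  by apply: (X_simplex_garside m_coxeter m_noniso Xrt); [left|right].
case/garside_edge_witness => [->|/edge_witness_setA[]|/edge_witness_setA[_]] //.
  by left.
by rewrite invgK.
Qed.

Lemma setB_garside : setB m a V0 = garside_set m a.
Proof.
apply/seteqP; split=> x.
  case=> [->|[sigma [tau [Xs Xt st ->]]]]; first by left.
  have [u su ->] := label_origin Xs; have [v tv ->] := label_origin Xt.
  (* The larger of the two simplices contains both [u] and [v]. *)
  case: st => [st|ts].
    by apply: (X_simplex_garside m_coxeter m_noniso Xt) => //; exact: st.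
  by apply: (X_simplex_garside m_coxeter m_noniso Xs) => //; exact: ts.
case/garside_edge_witness => [->|/edge_witness_setB[]|/edge_witness_setB[_]] //.
  by left.
by rewrite invgK.
Qed.

End Labels.

Theorem corollary7p3 (G : groupType) (n : nat) (m : 'M[option nat]_n)
    (a : 'I_n -> G) (V0 : set (set (vertex G n)))
    (m_coxeter : coxeter_matrix m)
    (m_large : almost_large_type m)
    (G_artin : artin_group m a)
    (G_nonfree : ~ free_group G)
    (m_noniso : no_isolated_generator m)
    (V0_reps : orbit_representatives setT (X_simplices m a) V0)
    (V0_v0 : V0 [set Real 1])
    (V0_based : forall (i j : 'I_n) (M : nat), i != j -> m i j = Some M ->
       orbit_representatives (parabolic a i j) (Xij_simplices a i j M)
         (V0 `&` Xij_simplices a i j M) /\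
       based_on a i j M (V0 `&` Xij_simplices a i j M)) :
  setA m a V0 = garside_set m a /\ setB m a V0 = garside_set m a.
Proof.
by split; [exact: setA_garside|exact: setB_garside].
Qed.
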